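(* Let $R$ be a finite commutative ring with identity such that the graph $\Gamma_{\mathrm{Aut}\,R}(R)$ is totally disconnected. Then $R$ is isomorphic to a finite direct product of rings each of which is of the form $\mathbb{Z}_{p^{\alpha}}$ ($p$ a prime, $\alpha\ge 1$ an integer) or $\mathbb{Z}_2[X]/(X^2)$.
   Context: All rings are commutative with identity; $\mathbb{Z}_n$ is the ring of integers modulo $n$. $\mathrm{Aut}\,R$ is the group of ring automorphisms of $R$. The graph $\Gamma_{\mathrm{Aut}\,R}(R)$ is the simple graph whose vertices are the elements of $R$, where two distinct vertices $x,y$ are adjacent if and only if there is $\sigma\in\mathrm{Aut}\,R$ with $\sigma(x)=y$. A graph is totally disconnected if it has no edges. *)

(* Defs.v *)
From HB Require Import structures.
From mathcomp Require Import all_boot all_order all_algebra.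

Set Implicit Arguments.
Unset Strict Implicit.
Unset Printing Implicit Defensive.

Import GRing.Theory.
Local Open Scope ring_scope.

Record simpleGraph := SimpleGraph {
  vertex :> Type;
  adj : vertex -> vertex -> Prop;
  adj_irr : forall x, ~ adj x x;
  adj_sym : forall x y, adj x y -> adj y x
}.

Definition totally_disconnected (G : simpleGraph) : Prop :=
  forall x y : G, ~ adj x y.

Definition ringAut (R : pzRingType) : Type :=
  {sigma : {rmorphism R -> R} | bijective sigma}.

Definition aut_adj (R : pzRingType) (x y : R) : Prop :=
  x <> y /\ exists sigma : ringAut R, sval sigma x = y.

Lemma aut_adj_irr (R : pzRingType) (x : R) : ~ aut_adj x x.
Proof. by case. Qed.

Lemma aut_adj_sym (R : pzRingType) (x y : R) : aut_adj x y -> aut_adj y x.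
Proof.
case=> neq_xy [[f bij_f] /= fx_y]; split; first by move=> /esym.
have [g fK gK] := bij_f.
pose gA := GRing.isZmodMorphism.Build R R g (can2_zmod_morphism fK gK).
pose gM := GRing.isMonoidMorphism.Build R R g (can2_monoid_morphism fK gK).
pose gR : {rmorphism R -> R} := HB.pack g gA gM.
have bij_g : bijective gR by exists f.
by exists (exist _ gR bij_g); rewrite /= -fx_y; apply: fK.
Qed.

Definition aut_graph (R : pzRingType) : simpleGraph :=
  SimpleGraph (@aut_adj_irr R) (@aut_adj_sym R).

Definition ring_isomorphic (R S : pzRingType) : Prop :=
  exists f : {rmorphism R -> S}, bijective f.

(* The alias keys the componentwise ring structure, which the library only
   provides for constant families. *)
Definition directProduct (n : nat) (S : 'I_n -> comPzRingType) : Type :=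
  {dffun forall i : 'I_n, S i}.

Section DirectProduct.
Variables (n : nat) (S : 'I_n -> comPzRingType).
Local Notation P := (directProduct S).
Implicit Types f g h : P.

HB.instance Definition _ := Choice.on P.

Definition dprod_zero : P := [ffun i => 0 : S i].
Definition dprod_opp f : P := [ffun i => - f i : S i].
Definition dprod_add f g : P := [ffun i => f i + g i : S i].
Definition dprod_one : P := [ffun i => 1 : S i].
Definition dprod_mul f g : P := [ffun i => f i * g i : S i].

Fact dprod_addA : associative dprod_add.
Proof. by move=> f g h; apply/ffunP=> i; rewrite !ffunE addrA. Qed.
Fact dprod_addC : commutative dprod_add.
Proof. by move=> f g; apply/ffunP=> i; rewrite !ffunE addrC. Qed.
Fact dprod_add0 : left_id dprod_zero dprod_add.
Proof. by move=> f; apply/ffunP=> i; rewrite !ffunE add0r. Qed.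
Fact dprod_addN : left_inverse dprod_zero dprod_opp dprod_add.
Proof. by move=> f; apply/ffunP=> i; rewrite !ffunE addNr. Qed.
Fact dprod_mulA : associative dprod_mul.
Proof. by move=> f g h; apply/ffunP=> i; rewrite !ffunE mulrA. Qed.
Fact dprod_mulC : commutative dprod_mul.
Proof. by move=> f g; apply/ffunP=> i; rewrite !ffunE mulrC. Qed.
Fact dprod_mul1 : left_id dprod_one dprod_mul.
Proof. by move=> f; apply/ffunP=> i; rewrite !ffunE mul1r. Qed.
Fact dprod_mulDl : left_distributive dprod_mul dprod_add.
Proof. by move=> f g h; apply/ffunP=> i; rewrite !ffunE mulrDl. Qed.

HB.instance Definition _ := GRing.isZmodule.Build P
  dprod_addA dprod_addC dprod_add0 dprod_addN.
HB.instance Definition _ := GRing.Zmodule_isComPzRing.Build P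
  dprod_mulA dprod_mulC dprod_mul1 dprod_mulDl.

Lemma dprod_addE f g i : (f + g) i = f i + g i.
Proof. by rewrite ffunE. Qed.
Lemma dprod_mulE f g i : (f * g) i = f i * g i.
Proof. by rewrite ffunE. Qed.
Lemma dprod_oneE i : (1 : P) i = 1.
Proof. by rewrite ffunE. Qed.
End DirectProduct.

(* [mk_monic] is the identity on the monic polynomial 'X^2, so the second
   ring really is the quotient by ('X^2). *)
Definition basic_ring (A : comPzRingType) : Prop :=
  (exists p alpha : nat,
     [/\ prime p, (1 <= alpha)%N & ring_isomorphic A 'Z_(p ^ alpha)]) \/
  ring_isomorphic A {poly %/ ('X^2 : {poly 'Z_2})}.

(* Main.v *)
(* A finite ring is the product of its corners [e R] over the primitive
   idempotents [e], and an automorphism of a corner extends by the identity on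
   the complementary factor; so one may assume that [R] is local, with
   nilpotent maximal ideal [m], of residue characteristic [p], and rigid (the
   identity is its only automorphism).  Let [q] be a power of [p] such that
   [x ^ q ^ 2 = x ^ q] for all [x]; the [x ^ q] are the Teichmueller elements.

   If [m <> p R], there is an ideal [H] with [p R + m ^ 2 <= H < m] and
   [m = H + t R].  For [s] in the socle, [x - x ^ q = r * t mod H |-> r * s] is
   a derivation [D] into the socle, [x |-> x + D x] is a nontrivial endomorphism,
   and [s] can be chosen to make it injective unless [R = {0, 1, t, 1 + t}] with
   [t ^ 2 = 2 = 0].

   If [m = p R], the subring of [R * R] generated by the pairs
   [(x ^ q, x ^ (q p))] is the graph of an automorphism lifting the Frobenius
   of the residue field.  Rigidity thus forces [R / m] to be the prime field,
   whence [R = Z / p ^ a]. *)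
Require Import Defs.
From HB Require Import structures.
From mathcomp Require Import all_boot all_order all_algebra.
From mathcomp Require Import all_field zify ring.

Set Implicit Arguments.
Unset Strict Implicit.
Unset Printing Implicit Defensive.

Import GRing.Theory.
Local Open Scope ring_scope.

(** * Iterates, subrings and Frobenius powers *)

(** By pigeonhole the orbit becomes periodic before index [#|T|] with period [j - i] at most [#|T|];
    the factorial exceeds the preperiod and is a multiple of the period. *)
Lemma iter_fact_card (T : finType) (f : T -> T) (x : T) :
  iter (#|T|`! + #|T|`!) f x = iter #|T|`! f x.
Proof.
have [i [j [ltij lej eqij]]] :
    exists i j, [/\ (i < j)%N, (j <= #|T|)%N & iter i f x = iter j f x].
  pose g (n : 'I_(#|T|.+1)) := iter n f x.
  have /injectivePn[i [j neqij eqij]] : ~~ injectiveb g.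
    apply/negP=> /injectiveP/leq_card; rewrite card_ord ltnn //.
  have [ltij|ltji|/val_inj eij] := ltngtP i j; last by rewrite eij eqxx in neqij.
    by exists i, j; split=> //; rewrite -ltnS.
  by exists j, i; split=> //; rewrite -ltnS.
have per n k : (i <= n)%N -> iter (k * (j - i) + n) f x = iter n f x.
  move=> lein; elim: k => [|k IHk]; first by rewrite mul0n.
  have -> : (k.+1 * (j - i) + n = (k * (j - i) + (n - i)) + j)%N.
    by rewrite mulSn; lia.
  rewrite iterD -eqij -iterD -addnA subnK //.
have card_gt0 : (0 < #|T|)%N by apply: leq_trans lej; apply: leq_trans ltij.
have lei : (i <= #|T|`!)%N.
  by rewrite (leq_trans _ (fact_geq _)) // (leq_trans _ lej) // ltnW.
have /dvdnP[k Ek] : (j - i %| #|T|`!)%N.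
  by rewrite dvdn_fact // subn_gt0 ltij (leq_trans _ lej) // leq_subr.
by rewrite {1}Ek per.
Qed.

(** [Prop]-valued because the main instance is an inductively generated subring of [A * A]; tracking
    [S] keeps the error terms of Frobenius powers inside it. *)
Record is_subring (P : comPzRingType) (S : P -> Prop) : Prop := Subring {
  subring1 : S 1;
  subringN : forall x, S x -> S (- x);
  subringD : forall x y, S x -> S y -> S (x + y);
  subringM : forall x y, S x -> S y -> S (x * y)
}.

Section Subring.
Variables (P : comPzRingType) (S : P -> Prop).
Hypothesis subS : is_subring S.

Lemma subring0 : S 0.
Proof.
rewrite -(subrr 1); apply: (subringD subS) (subring1 subS) _.
exact: (subringN subS) (subring1 subS).
Qed.

Lemma subring_muln x n : S x -> S (x *+ n).
Proof.
move=> Sx; elim: n => [|n IHn]; first by rewrite mulr0n; apply: subring0.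
by rewrite mulrS; apply: (subringD subS).
Qed.

Lemma subring_exp x n : S x -> S (x ^+ n).
Proof.
move=> Sx; elim: n => [|n IHn]; first by rewrite expr0; apply: (subring1 subS).
by rewrite exprS; apply: (subringM subS).
Qed.

(** The inner binomial coefficients are multiples of [p]. *)
Lemma exprD_prime p x y : prime p -> S x -> S y ->
  exists2 e, S e & (x + y) ^+ p = x ^+ p + y ^+ p + e *+ p.
Proof.
case: p => // p pr_p Sx Sy.
exists (\sum_(i < p) (x ^+ (p - i) * y ^+ i.+1) *+ ('C(p.+1, i.+1) %/ p.+1)).
  apply: (big_ind S); [exact: subring0 | exact: (subringD subS) |] => i _.
  by apply: subring_muln; apply: (subringM subS) => //; apply: subring_exp.
rewrite exprDn big_ord_recl big_ord_recr /= subn0 subnn !expr0 bin0 binn.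
rewrite /bump /= mulr1 mul1r !mulr1n addrAC addrA; congr (_ + _ + _).
rewrite -sumrMnl; apply: eq_bigr => i _.
rewrite /bump /= -mulrnA add1n subSS divnK // prime_dvd_bin //= ltnS.
exact: ltn_ord.
Qed.

Lemma exprD_prime_power p n x y : prime p -> S x -> S y ->
  exists2 e, S e & (x + y) ^+ (p ^ n) = x ^+ (p ^ n) + y ^+ (p ^ n) + e *+ p.
Proof.
move=> pr_p Sx Sy; elim: n => [|n [e Se IHn]].
  by exists 0; [exact: subring0 | rewrite mul0rn addr0].
rewrite !expnSr !exprM IHn.
set X := x ^+ _; set Y := y ^+ _.
have SX : S X by apply: subring_exp.
have SY : S Y by apply: subring_exp.
have [e1 Se1 ->] := exprD_prime pr_p (subringD subS SX SY) (subring_muln p Se).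
have [e2 Se2 ->] := exprD_prime pr_p SX SY.
(* The old error [e *+ p] is itself raised to the power [p], giving [e ^+ p *+ p ^ p], from which
   one factor [p] is extracted. *)
exists (e2 + e1 + e ^+ p *+ p ^ p.-1).
  apply: (subringD subS) => //; first exact: (subringD subS).
  by apply: subring_muln; apply: subring_exp.
rewrite exprMn_n -[in e ^+ p *+ p ^ p](prednK (prime_gt0 pr_p)) expnSr mulrnA.
by rewrite (prednK (prime_gt0 pr_p)) !mulrnDl !addrA; ring.
Qed.
End Subring.

Lemma subringT (P : comPzRingType) : is_subring (fun _ : P => True).
Proof. by []. Qed.

Lemma ring_isomorphic_sym (R S : pzRingType) :
  ring_isomorphic R S -> ring_isomorphic S R.
Proof.
case=> f [g fK gK].
pose gA := GRing.isZmodMorphism.Build S R g (can2_zmod_morphism fK gK).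
pose gM := GRing.isMonoidMorphism.Build S R g (can2_monoid_morphism fK gK).
pose gR : {rmorphism S -> R} := HB.pack g gA gM.
by exists gR; exists f.
Qed.

Definition rigid (R : pzRingType) : Prop :=
  forall f : {rmorphism R -> R}, bijective f -> f =1 id.

Lemma rigid_fun (A : finComPzRingType) (f : A -> A) : rigid A ->
  f 1 = 1 -> {morph f : x y / x + y} -> {morph f : x y / x * y} ->
  injective f -> f =1 id.
Proof.
move=> rigidA f1 fD fM f_inj.
have f0 : f 0 = 0 by apply: (addrI (f 0)); rewrite -fD !addr0.
have fB : zmod_morphism f.
  move=> x y; rewrite fD; congr (_ + _).
  by apply: (addrI (f y)); rewrite -fD !subrr.
pose fA := GRing.isZmodMorphism.Build A A f fB.
pose fMm := GRing.isMonoidMorphism.Build A A f (f1, fM).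
pose fR : {rmorphism A -> A} := HB.pack f fA fMm.
exact: (rigidA fR (injF_bij f_inj)).
Qed.

(** * Finite local rings *)

(* Raising to the power [#|A|`!] yields an idempotent in any finite ring. *)
Definition nilpotent (A : finComNzRingType) : pred A :=
  fun x => x ^+ #|A|`! == 0.

Section LocalRing.
Variable A : finComNzRingType.
Hypothesis idemA : forall e : A, e * e = e -> e = 0 \/ e = 1.
Implicit Types (x y z s t : A) (n : nat).
Local Notation d := (#|A|`!).
Local Notation nil := (@nilpotent A).

(** Powers of [x] are iterates of multiplication by [x] on [1], so [x ^+ d] is idempotent. *)
Lemma expr_fact_card x : x ^+ d = 0 \/ x ^+ d = 1.
Proof.
apply: idemA; rewrite -exprD -!iter_mulr_1.
exact: iter_fact_card.
Qed.

Lemma nilpotentP x n : x ^+ n = 0 -> nil x.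
Proof.
move=> xn0; rewrite /nilpotent; have [->|xd1] := expr_fact_card x; first by [].
suff /eqP : (1 : A) = 0 by rewrite oner_eq0.
by rewrite -(expr1n A n) -{1}xd1 exprAC xn0 expr0n gtn_eqF ?fact_gt0.
Qed.

Lemma nilpotent_exp x n : nil x -> (d <= n)%N -> x ^+ n = 0.
Proof. by move=> /eqP xd0 /subnK <-; rewrite exprD xd0 mulr0. Qed.

Lemma nilpotentXn x n : nil (x ^+ n) -> nil x.
Proof. by move=> /eqP; rewrite -exprM => /nilpotentP. Qed.

Lemma nilpotent0 : nil 0.
Proof. by apply: (@nilpotentP _ 1%N). Qed.

Lemma nilpotent1 : nil 1 = false.
Proof. by rewrite /nilpotent expr1n oner_eq0. Qed.

Lemma unit_of_not_nilpotent x : ~~ nil x -> exists y, x * y = 1.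
Proof.
rewrite /nilpotent; have [->|xd1 _] := expr_fact_card x; first by rewrite eqxx.
by exists (x ^+ d.-1); rewrite -exprS prednK ?fact_gt0.
Qed.

Lemma nilpotentMl x y : nil x -> nil (x * y).
Proof. by rewrite /nilpotent exprMn => /eqP ->; rewrite mul0r. Qed.

Lemma nilpotentMr x y : nil y -> nil (x * y).
Proof. by rewrite mulrC; apply: nilpotentMl. Qed.

Lemma nilpotentN x : nil x -> nil (- x).
Proof. by rewrite -mulrN1; apply: nilpotentMl. Qed.

Lemma nilpotentM x y : nil (x * y) -> nil x \/ nil y.
Proof.
rewrite /nilpotent exprMn; have [->|->] := expr_fact_card x; first by left.
by rewrite mul1r; right.
Qed.

Lemma not_nilpotent_1B x : nil x -> ~~ nil (1 - x).
Proof.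
move=> /eqP xd0; apply/negP => nil1x; have := subrX1 x d.
rewrite xd0 sub0r => /esym/(congr1 -%R); rewrite opprK -mulNr opprB => E.
by have := nilpotentMl (\sum_(i < d) x ^+ i) nil1x; rewrite E nilpotent1.
Qed.

Lemma nilpotentD x y : nil x -> nil y -> nil (x + y).
Proof.
move=> nx ny; apply/negPn/negP => /unit_of_not_nilpotent[z].
rewrite mulrDl => /(canRL (addKr _)) E; rewrite addrC in E.
by have := not_nilpotent_1B (nilpotentMl z nx); rewrite -E nilpotentMl.
Qed.

Lemma nilpotentB x y : nil x -> nil y -> nil (x - y).
Proof. by move=> nx ny; apply/nilpotentD/nilpotentN. Qed.

(** Iterating [+ 1] shows that [d] vanishes in [A]; as nilpotents form a prime ideal, splitting off
    prime factors of [d] must reach a nilpotent one. *)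
Lemma exists_nilpotent_prime : exists2 p, prime p & nil p%:R.
Proof.
have d0 : nil d%:R.
  have := iter_fact_card (+%R (1 : A)) 0; rewrite !iter_addr_0 mulrnDr.
  by move/(canRL (addrK _)) ->; rewrite subrr nilpotent0.
have: (0 < d)%N by apply: fact_gt0.
move: (d) d0; apply: ltn_ind => n IHn nil_n n_gt0.
have [n_gt1|] := ltnP 1 n; last first.
  by case: n n_gt0 nil_n {IHn} => [|[|]] //; rewrite nilpotent1.
have pr_p := pdiv_prime n_gt1.
move: nil_n; rewrite -{1}(divnK (pdiv_dvd n)) natrM.
case/nilpotentM; last by exists (pdiv n).
move=> nil_n; apply: IHn nil_n _.
  by apply: ltn_Pdiv => //; apply: prime_gt1.
by rewrite divn_gt0 ?pdiv_gt0 // dvdn_leq ?pdiv_dvd.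
Qed.

(** * Teichmueller elements in residue characteristic [p] *)

Section ResidueChar.
Variable p : nat.
Hypotheses (pr_p : prime p) (nil_p : nil p%:R).
Local Notation q := (p ^ d)%N.

Lemma nilpotent_muln x : nil (x *+ p).
Proof. by rewrite -mulr_natr nilpotentMr. Qed.

Lemma teichmuller x : x ^+ (q * q) = x ^+ q.
Proof.
have iterX n y : iter n (fun z => z ^+ p) y = y ^+ (p ^ n).
  by elim: n => //= n ->; rewrite -exprM expnSr.
by rewrite -expnD -!iterX iter_fact_card.
Qed.

Lemma exprD_q x y : exists e, (x + y) ^+ q = x ^+ q + y ^+ q + e *+ p.
Proof.
by have [e _ ->] := @exprD_prime_power _ _ (@subringT A) p d x y pr_p I I; exists e.
Qed.

Lemma exprD_p x y : exists e, (x + y) ^+ p = x ^+ p + y ^+ p + e *+ p.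
Proof.
by have [e _ ->] := @exprD_prime _ _ (@subringT A) p x y pr_p I I; exists e.
Qed.

Lemma q_gt1 : (1 < q)%N.
Proof. by rewrite -[1%N](expn0 p) ltn_exp2l ?prime_gt1 ?fact_gt0. Qed.

(** Modulo [p] the [q]-th power is additive and fixes [x ^+ q], so it kills the difference.
    Expanding [((x - x ^+ q) + x ^+ q) ^+ q] avoids the sign of a power of [-1]. *)
Lemma nilpotent_sub_teichmuller x : nil (x - x ^+ q).
Proof.
have [e] := exprD_q (x - x ^+ q) (x ^+ q).
rewrite subrK -exprM teichmuller => E; apply: (@nilpotentXn _ q).
have -> : (x - x ^+ q) ^+ q = - (e *+ p).
  apply/eqP; rewrite -subr_eq0 opprK; apply/eqP.
  by apply: (addrI (x ^+ q)); rewrite addr0 [in RHS]E; ring.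
exact/nilpotentN/nilpotent_muln.
Qed.


(** * Ideals, the socle and the ramified case *)

Definition is_ideal (H : {set A}) : bool :=
  [&& 0 \in H, [forall x in H, forall y in H, x + y \in H]
    & [forall a, forall x in H, a * x \in H]].

Lemma is_idealP (H : {set A}) :
  reflect [/\ 0 \in H, forall x y, x \in H -> y \in H -> x + y \in H
             & forall a x, x \in H -> a * x \in H] (is_ideal H).
Proof.
apply: (iffP and3P) => [[H0 /forall_inP HD /forallP HM]|[H0 HD HM]].
  split=> // [x y Hx|a x]; first by have /forall_inP := HD x Hx; apply.
  by have /forall_inP := HM a; apply.
split=> //; first by apply/forall_inP=> x Hx; apply/forall_inP=> y; apply: (HD x).
by apply/forallP=> a; apply/forall_inP=> x; apply: HM.
Qed.

(** Take a nonzero [s] in [I] with the smallest principal ideal. If [x * s] were nonzero it would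
    generate the same ideal, so [s = a * x * s] with [1 - a * x] a unit, forcing [s = 0]. *)
Lemma exists_socle (I : {set A}) y : is_ideal I -> y \in I -> y != 0 ->
  exists s, [/\ s \in I, s != 0 & forall x, nil x -> x * s = 0].
Proof.
case/is_idealP=> _ _ IM Iy y0.
pose F z := #|[set a * z | a : A]|.
have Py : (y \in I) && (y != 0) by rewrite Iy.
have [s /andP[Is s0] min_s] :=
  @arg_minnP _ y (fun z => (z \in I) && (z != 0)) F Py.
exists s; split=> // x nil_x; apply/eqP/negPn/negP => xs0.
have sub : [set a * (x * s) | a : A] \subset [set a * s | a : A].
  by apply/subsetP=> _ /imsetP[a _ ->]; rewrite mulrA; apply: imset_f.
have := min_s (x * s); rewrite IM // xs0 => /(_ isT) le_s.
have /eqP E : [set a * (x * s) | a : A] == [set a * s | a : A] by rewrite eqEcard sub.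
have : s \in [set a * (x * s) | a : A].
  by rewrite E; apply/imsetP; exists 1; rewrite ?mul1r.
case/imsetP=> a _ Es; have := not_nilpotent_1B (nilpotentMr a nil_x).
case/unit_of_not_nilpotent=> u Eu; case/eqP: s0.
by rewrite -[s]mul1r -Eu mulrAC mulrBl mul1r -mulrA -Es subrr mul0r.
Qed.

(* By maximality of [H], Nakayama's lemma reduces to: if [x * t] with [x]
   nilpotent generated the maximal ideal modulo [H], so would [0]. *)
Lemma exists_submaximal_ideal z : nil z -> (forall y, z != p%:R * y) ->
  exists (H : {set A}) (t : A),
    [/\ is_ideal H, p%:R \in H, nil t & t \notin H] /\
    [/\ forall x, x \in H -> nil x,
        forall x, nil x -> exists r, x - r * t \in H
      & forall x y, nil x -> nil y -> x * y \in H].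
Proof.
move=> nil_z z_notin.
pose m := [set x | nil x].
pose P (H : {set A}) := [&& is_ideal H, p%:R \in H & H \proper m].
pose H0 : {set A} := [set p%:R * y | y : A].
have PH0 : P H0.
  apply/and3P; split.
  - apply/is_idealP; split=> [|_ _ /imsetP[x _ ->] /imsetP[y _ ->]|a _ /imsetP[x _ ->]].
    + by apply/imsetP; exists 0; rewrite ?mulr0.
    + by rewrite -mulrDr imset_f.
    + by rewrite mulrCA imset_f.
  - by apply/imsetP; exists 1; rewrite ?mulr1.
  - apply/properP; split.
      by apply/subsetP=> _ /imsetP[x _ ->]; rewrite inE nilpotentMl.
    exists z; rewrite ?inE //; apply/imsetP=> -[y _ /eqP].
    by rewrite (negPf (z_notin y)).
have [H /maxsetP[/and3P[idH Hp /properP[sHm [t mt Ht]]] maxH] _] := maxset_exists PH0.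
have nil_t : nil t by move: mt; rewrite inE.
exists H, t.
have /is_idealP[H_0 HD HM] := idH.
(* The ideal [K = H + A y] lies strictly above [H] and inside [m], so maximality gives [K = m]. *)
have gen y : nil y -> y \notin H -> forall x, nil x -> exists r, x - r * y \in H.
  move=> nil_y Hy x nil_x.
  pose K := [set u | [exists r, u - r * y \in H]].
  have sHK : H \subset K.
    by apply/subsetP=> u Hu; rewrite inE; apply/existsP; exists 0; rewrite mul0r subr0.
  have Ky : y \in K by rewrite inE; apply/existsP; exists 1; rewrite mul1r subrr.
  have idK : is_ideal K.
    apply/is_idealP; split=> [|u v|a u]; first exact: (subsetP sHK).
    - rewrite !inE => /existsP[r Hr] /existsP[r' Hr']; apply/existsP; exists (r + r').
      by rewrite mulrDl opprD addrACA HD.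
    - rewrite !inE => /existsP[r Hr]; apply/existsP; exists (a * r).
      by rewrite -mulrA -mulrBr HM.
  have sKm : K \subset m.
    apply/subsetP=> u; rewrite !inE => /existsP[r Hr].
    rewrite -(subrK (r * y) u) nilpotentD ?nilpotentMr //.
    by have := subsetP sHm _ Hr; rewrite inE.
  have [/eqP|neqKm] := altP (K =P m).
    by move/eqP=> EK; have : x \in K; [rewrite EK inE | rewrite inE => /existsP].
  have PK : P K by rewrite /P idK (subsetP sHK) // properEneq neqKm.
  by move: Hy; rewrite -(maxH K PK sHK) Ky.
have Hmt x : nil x -> x * t \in H.
  move=> nil_x; apply/negPn/negP=> Hxt.
  have [r] := gen (x * t) (nilpotentMl t nil_x) Hxt t nil_t.
  rewrite mulrA -{1}[t]mul1r -mulrBl => Hrt; case/negP: Ht.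
  have [u Eu] := unit_of_not_nilpotent (not_nilpotent_1B (nilpotentMr r nil_x)).
  by rewrite -[t]mul1r -Eu [_ * u]mulrC -mulrA HM.
split; split=> // [x Hx|x nil_x|x y nil_x nil_y].
- by have := subsetP sHm _ Hx; rewrite inE.
- exact: gen.
have [r Hr] := gen t nil_t Ht y nil_y.
rewrite -(subrK (r * t) y) mulrDr mulrA.
by apply: HD; [apply: HM | apply/Hmt/nilpotentMl].
Qed.

(* The automorphism is [x |-> x + D x], where [D] is the derivation of [A]
   with values in the socle given by [D x = r * s] for
   [x - x ^+ q = r * t] modulo [H]. *)
Lemma derivation_not_rigid (H : {set A}) t s :
    is_ideal H -> p%:R \in H -> nil t -> t \notin H ->
    (forall x, nil x -> exists r, x - r * t \in H) ->
    (forall x y, nil x -> nil y -> x * y \in H) ->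
    s != 0 -> (forall x, nil x -> x * s = 0) ->
    (forall r u, r * s - (r * s) ^+ q - u * t \in H ->
       r * s + u * s = 0 -> r * s = 0) ->
  ~ rigid A.
Proof.
move=> /is_idealP[H0 HD HM] Hp nil_t Ht Hgen Hnil s0 soc_s inj_s rigidA.
have HB x y : x \in H -> y \in H -> x - y \in H.
  by move=> Hx Hy; rewrite HD // -mulN1r HM.
have Hpn x : x *+ p \in H by rewrite -mulr_natr HM.
(* A unit [r] would put [t] in [H], so [r] is nilpotent and kills the socle. This makes [D] well
   defined. *)
have ann r : r * t \in H -> r * s = 0.
  move=> Hrt; apply: soc_s; apply/negPn/negP => /unit_of_not_nilpotent[u ru].
  by case/negP: Ht; rewrite -[t]mul1r -ru [r * u]mulrC -mulrA HM.
have nil_s : nil s.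
  apply/negPn/negP => /unit_of_not_nilpotent[u su].
  by case/negP: Ht; rewrite -[t]mulr1 -su mulrA soc_s // mul0r.
have [D DP] : exists D : A -> A,
    forall x, exists2 r, x - x ^+ q - r * t \in H & D x = r * s.
  apply: (@fin_all_exists A (fun _ => A)
    (fun x c => exists2 r, x - x ^+ q - r * t \in H & c = r * s)) => x.
  have [r Hr] := Hgen _ (nilpotent_sub_teichmuller x).
  by exists (r * s), r.
have D_uniq x r : x - x ^+ q - r * t \in H -> D x = r * s.
  move=> Hr; have [r' Hr' ->] := DP x; apply/eqP; rewrite -subr_eq0 -mulrBl.
  apply/eqP/ann; have := HB _ _ Hr Hr'; congr (_ \in H); ring.
have DD x y : D (x + y) = D x + D y.
  have [r1 Hr1 ->] := DP x; have [r2 Hr2 ->] := DP y.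
  rewrite -mulrDl; apply: D_uniq; have [e ->] := exprD_q x y.
  have := HB _ _ (HD _ _ Hr1 Hr2) (Hpn e); congr (_ \in H); ring.
have D1 : D 1 = 0.
  by rewrite (D_uniq 1 0) ?mul0r // expr1n subrr subr0.
have DM x y : D (x * y) = x * D y + y * D x.
  have [r1 Hr1 ->] := DP x; have [r2 Hr2 ->] := DP y.
  rewrite !mulrA -mulrDl; apply: D_uniq; rewrite exprMn.
  (* The Leibniz rule holds up to the product of the two nilpotent parts, which lies in [H]. *)
  have nn := Hnil _ _ (nilpotent_sub_teichmuller x) (nilpotent_sub_teichmuller y).
  have := HB _ _ (HD _ _ (HM x _ Hr2) (HM y _ Hr1)) nn; congr (_ \in H); ring.
have DD0 x y : D x * D y = 0.
  have [r1 _ ->] := DP x; have [r2 _ ->] := DP y.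
  by rewrite mulrACA [s * s]soc_s // mulr0.
pose f x := x + D x.
have fid : f =1 id.
  apply: rigid_fun => // [|x y|x y|x y].
  - by rewrite /f D1 addr0.
  - by rewrite /f DD addrACA.
  - rewrite /f DM -[LHS]addr0 -(DD0 x y); ring.
  (* A kernel element [x - y] equals [- D (x - y)], hence is a multiple of [s]; [inj_s] is exactly
     what makes it vanish. *)
  - move=> fxy; apply/eqP; rewrite -subr_eq0; apply/eqP.
    have Dxy : D (x - y) = - (x - y).
      have E : D x = D (x - y) + D y by rewrite -DD subrK.
      move: fxy; rewrite /f E => /eqP; rewrite -subr_eq0 => /eqP F.
      by apply/eqP; rewrite -subr_eq0; apply/eqP; rewrite -[RHS]F; ring.
    have [r Hr Er] := DP (x - y).
    have Exy : x - y = (- r) * s by rewrite mulNr -Er Dxy opprK.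
    rewrite Exy in Hr *; apply: inj_s Hr _.
    by rewrite mulNr addNr.
(* Since [t ^+ q] is in [H], one has [(1 - r) * t] in [H], so [D t = s]; rigidity gives [D t = 0], a
   contradiction. *)
have [r Hr Er] := DP t.
have Drt : D t = 0 by apply: (addrI t); rewrite addr0; apply: fid.
have Hrt : (1 - r) * t \in H.
  have Htq : t ^+ q \in H.
    by case: q q_gt1 => [|[|k]] // _; rewrite !exprS mulrA mulrC HM // Hnil.
  have := HD _ _ Hr Htq; congr (_ \in H); ring.
case/eqP: s0; have := ann _ Hrt.
by rewrite mulrBl mul1r -Er Drt subr0.
Qed.

Lemma ramified_rigid z : nil z -> (forall y, z != p%:R * y) -> rigid A ->
  exists t, [/\ (2%:R : A) = 0, t != 0, t * t = 0
               & forall x, [\/ x = 0, x = 1, x = t | x = 1 + t]].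
Proof.
move=> nil_z z_notin rigidA.
have [H [t [[idH Hp nil_t Ht] [Hsub Hgen Hnil]]]] :=
  exists_submaximal_ideal nil_z z_notin.
have noaut := derivation_not_rigid idH Hp nil_t Ht Hgen Hnil.
have /is_idealP[H_0 HD HM] := idH.
(* Otherwise choose [s] in the socle inside [H]. A kernel relation then gives [u * t] in [H], so [u]
   is nilpotent, [u * s = 0], and the endomorphism is injective. *)
have H0 y : y \in H -> y = 0.
  move=> Hy; apply/eqP/negPn/negP => y0.
  have [s [Hs s0 soc_s]] := exists_socle idH Hy y0.
  case: (noaut s s0 soc_s _ rigidA) => r u Hru.
  have Hut : u * t \in H.
    have Hrs : r * s \in H by apply: HM.
    have Hrq : (r * s) ^+ q \in H.
      by rewrite -(prednK (ltnW q_gt1)) exprSr HM.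
    have := HD _ _ (HD _ _ Hrs (HM (-1) _ Hrq)) (HM (-1) _ Hru).
    by congr (_ \in H); ring.
  rewrite [u * s]soc_s ?addr0 //; apply/negPn/negP => /unit_of_not_nilpotent[v uv].
  by case/negP: Ht; rewrite -[t]mul1r -uv [u * v]mulrC -mulrA HM.
have m20 x y : nil x -> nil y -> x * y = 0.
  by move=> nil_x nil_y; apply/H0/Hnil.
have t0 : t != 0 by apply: contraNneq Ht => ->.
(* Now the maximal ideal [A t] has square zero and [s = c * t] is allowed. Injectivity fails only if
   [1 + c] is not a unit, so the residue field has two elements. *)
have no_unit c : ~~ nil c -> nil (1 + c).
  move=> nc; apply/negPn/negP => nc1.
  have [v cv] := unit_of_not_nilpotent nc.
  have [w cw] := unit_of_not_nilpotent nc1.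
  case: (noaut (c * t) _ _ _ rigidA) => [|x nil_x|r u /H0].
  - apply: contraNneq t0 => ct0.
    by rewrite -[t]mul1r -cv mulrAC ct0 mul0r.
  - by rewrite mulrCA (m20 x t) ?mulr0.
  - have -> : (r * (c * t)) ^+ q = 0.
      by rewrite -(subnK q_gt1) exprD expr2 [X in _ * X]m20 ?mulr0 // !nilpotentMr.
    rewrite subr0 => /eqP; rewrite subr_eq0 => /eqP ->.
    move=> E; have : (1 + c) * (u * t) = 0 by rewrite -[RHS]E; ring.
    move=> /(congr1 ( *%R w)); rewrite mulr0 mulrA [w * _]mulrC cw mul1r //.
have nil2 : nil 2%:R by rewrite [2%:R]/(1 + 1); apply: no_unit; rewrite nilpotent1.
have p0 : (p%:R : A) = 0 by apply: H0.
(* For odd [p], [1 + 2 * (p./2) = p = 0] would be both nilpotent and a unit. *)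
have two0 : (2%:R : A) = 0.
  case: (even_prime pr_p) => [<- //|odd_p].
  have := not_nilpotent_1B (nilpotentN (nilpotentMl (p./2)%:R nil2)).
  have E : p = (p./2).*2.+1 by rewrite -{1}(odd_double_half p) odd_p.
  by rewrite opprK -natrM mul2n nat1r -E p0 nilpotent0.
have opp x : - x = x.
  by apply/eqP; rewrite -subr_eq0 -opprD oppr_eq0 -mulr2n -mulr_natr two0 mulr0.
have nilE x : nil x -> x = 0 \/ x = t.
  move=> nil_x; have [r /H0/eqP] := Hgen x nil_x; rewrite subr_eq0 => /eqP ->.
  have [nil_r|/no_unit nil_r] := boolP (nil r); first by left; rewrite m20.
  right; have := m20 _ _ nil_r nil_t; rewrite mulrDl mul1r.
  by move=> /eqP; rewrite addrC addr_eq0 opp => /eqP.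
exists t; split=> // [|x]; first exact: m20.
have [/nilE[]|/no_unit/nilE[]] := boolP (nil x); first by constructor 1.
- by constructor 3.
- by move=> /eqP; rewrite addrC addr_eq0 opp => /eqP; constructor 2.
by move=> /(congr1 (+%R 1)); rewrite addrA -[1 + 1]/2%:R two0 add0r; constructor 4.
Qed.

(** * The lift of Frobenius and the unramified case *)

(* The pairs [(x ^+ q, x ^+ (q * p))] are the Teichmueller representatives
   and their images under the sought lift of Frobenius. *)
Inductive frobenius_lift : A * A -> Prop :=
| FrobeniusTeichmuller x : frobenius_lift (x ^+ q, x ^+ (q * p))
| FrobeniusD (z1 z2 : A * A) :
    frobenius_lift z1 -> frobenius_lift z2 -> frobenius_lift (z1 + z2)
| FrobeniusN (z1 : A * A) : frobenius_lift z1 -> frobenius_lift (- z1).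

(** Teichmueller pairs are closed under products, so their additive span is too. *)
Lemma frobenius_lift_subring : is_subring frobenius_lift.
Proof.
split.
- by have := FrobeniusTeichmuller 1; rewrite !expr1n.
- exact: FrobeniusN.
- exact: FrobeniusD.
move=> z1 z2 Fz1 Fz2; elim: Fz1 => [x|u v _ Fu _ Fv|u _ Fu].
- elim: Fz2 => [y|u v _ Fu _ Fv|u _ Fu].
  + have -> : (x ^+ q, x ^+ (q * p)) * (y ^+ q, y ^+ (q * p))
      = ((x * y) ^+ q, (x * y) ^+ (q * p)) by rewrite !exprMn.
    exact: FrobeniusTeichmuller.
  + by rewrite mulrDr; apply: FrobeniusD.
  + by rewrite mulrN; apply: FrobeniusN.
- by rewrite mulrDl; apply: FrobeniusD.
- by rewrite mulNr; apply: FrobeniusN.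
Qed.
Let subF := frobenius_lift_subring.

Lemma pair_exp (z : A * A) n : z ^+ n = (z.1 ^+ n, z.2 ^+ n).
Proof. by elim: n => [|n IHn]; rewrite ?expr0 // !exprS IHn. Qed.

Lemma pair_muln (z : A * A) n : z *+ n = (z.1 *+ n, z.2 *+ n).
Proof. by elim: n => [|n IHn]; rewrite ?mulr0n // !mulrS IHn. Qed.

Lemma frobenius_lift_exp_q (z : A * A) : frobenius_lift z ->
  exists2 c, frobenius_lift c & z ^+ q = z + c *+ p.
Proof.
elim=> [x|z1 z2 Fz1 [c1 Fc1 E1] Fz2 [c2 Fc2 E2]|z1 Fz1 [c1 Fc1 E1]].
- exists 0; first exact: subring0.
  rewrite mul0rn addr0 pair_exp /= -exprM teichmuller.
  by rewrite -[in LHS]exprM mulnAC exprM teichmuller -exprM.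
- have [e Fe ->] := exprD_prime_power subF d pr_p Fz1 Fz2.
  exists (c1 + c2 + e); first by do ![apply: FrobeniusD => //].
  by rewrite E1 E2; ring.
(* Expanding [(z1 - z1) ^+ q = 0] treats negation without a case split on the parity of [p]. *)
have [e Fe] := exprD_prime_power subF d pr_p Fz1 (FrobeniusN Fz1).
rewrite subrr expr0n gtn_eqF ?expn_gt0 ?prime_gt0 // E1 => E.
exists (- c1 - e); first by apply: FrobeniusD; apply: FrobeniusN.
by apply/eqP; rewrite -subr_eq0; apply/eqP; rewrite [RHS]E; ring.
Qed.

Lemma frobenius_lift_congr (z : A * A) :
  frobenius_lift z -> nil (z.1 ^+ p - z.2).
Proof.
elim=> [x|u v _ nu _ nv|u _ nu] /=.
- by rewrite -exprM subrr nilpotent0.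
- have [e ->] := exprD_p u.1 v.1.
  have -> : u.1 ^+ p + v.1 ^+ p + e *+ p - (u.2 + v.2)
    = (u.1 ^+ p - u.2) + (v.1 ^+ p - v.2) + e *+ p by ring.
  by apply: nilpotentD (nilpotent_muln e); apply: nilpotentD.
have [e] := exprD_p u.1 (- u.1).
rewrite subrr expr0n gtn_eqF ?prime_gt0 // => E.
have -> : (- u.1) ^+ p - - u.2 = - (u.1 ^+ p - u.2) - e *+ p.
  by apply/eqP; rewrite -subr_eq0; apply/eqP; rewrite [RHS]E; ring.
by apply: nilpotentB (nilpotent_muln e); apply: nilpotentN.
Qed.

Lemma frobenius_lift_nilpotent (z : A * A) :
  frobenius_lift z -> nil z.1 = nil z.2.
Proof.
move=> /frobenius_lift_congr nil_frob; apply/idP/idP => [nil1|nil2].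
  rewrite -[z.2](subKr (z.1 ^+ p)) nilpotentB //.
  by rewrite -(prednK (prime_gt0 pr_p)) exprS nilpotentMl.
by apply: (@nilpotentXn _ p); rewrite -(subrK z.2 (z.1 ^+ p)) nilpotentD.
Qed.

(* Modulo [p] every element of the subring equals its [q]-th power, so that
   subring has no nilpotents other than the multiples of [p]. *)
Lemma frobenius_lift_divp (z : A * A) : frobenius_lift z -> nil z.1 ->
  exists2 c, frobenius_lift c & z = c *+ p.
Proof.
move=> Fz nil_z1.
have nil_z2 : nil z.2 by rewrite -frobenius_lift_nilpotent.
have iter_q N : exists2 c, frobenius_lift c & z ^+ (q ^ N) = z + c *+ p.
  elim: N => [|N [c Fc IHN]].
    by exists 0; [apply: subring0 | rewrite mul0rn addr0].
  rewrite expnSr exprM IHN.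
  have [e Fe ->] := exprD_prime_power subF d pr_p Fz (subring_muln subF p Fc).
  have [c' Fc' ->] := frobenius_lift_exp_q Fz.
  exists (c' + e + c ^+ q *+ p ^ q.-1).
    do ![apply: FrobeniusD => //].
    by apply: subring_muln => //; apply: subring_exp.
  rewrite exprMn_n -[in c ^+ q *+ p ^ q](prednK (ltnW q_gt1)) expnSr mulrnA.
  by rewrite (prednK (ltnW q_gt1)); ring.
(* As [d < q ^ d], both coordinates of [z ^+ (q ^ d)] vanish, leaving [z = - c *+ p]. *)
have [c Fc] := iter_q d; rewrite pair_exp !nilpotent_exp ?(ltnW (ltn_expl _ q_gt1)) //.
move=> E; exists (- c); first exact: FrobeniusN.
by apply/eqP; rewrite -subr_eq0; apply/eqP; rewrite [RHS]E; ring.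
Qed.

(** If [n] vanishes in [A], so does its gcd with [p ^ a], a power of [p]; minimality of [a] makes
    that gcd [p ^ a]. *)
Lemma exists_characteristic_exponent : exists a, [/\ (0 < a)%N, ((p ^ a)%:R : A) = 0
  & forall n, (n%:R : A) = 0 -> (p ^ a %| n)%N].
Proof.
have ex : exists b, (p ^ b)%:R == 0 :> A by exists d; rewrite natrX.
case: (ex_minnP ex) => a /eqP pa0 min_a; exists a; split=> //.
  by case: a pa0 {min_a} => // /eqP; rewrite oner_eq0.
move=> n n0; have pa_gt0 : (0 < p ^ a)%N by rewrite expn_gt0 prime_gt0.
have [k _ /dvdnP[l El]] := Bezoutl n pa_gt0.
have g0 : (gcdn (p ^ a) n)%:R = 0 :> A.
  have := congr1 (fun m => m%:R : A) El.
  by rewrite natrD !natrM n0 pa0 !mulr0 addr0.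
have /(dvdn_pfactor _ _ pr_p)[b leba Eg] := dvdn_gcdl (p ^ a) n.
rewrite (_ : a = b) -?Eg ?dvdn_gcdr //.
by apply/eqP; rewrite eqn_leq leba andbT min_a // -Eg g0.
Qed.

(** Descending induction on [i]: a nilpotent [z] is [c *+ p], which passes to [i.+1]; otherwise both
    coordinates are units, not killed by [p ^ i] for [i < a]. The case [i = 0] makes the subring the
    graph of an injective partial map. *)
Lemma frobenius_lift_annihilator a i j (z : A * A) :
    ((p ^ a)%:R : A) = 0 -> (forall n, (n%:R : A) = 0 -> (p ^ a %| n)%N) ->
    (i + j)%N = a -> frobenius_lift z ->
  (z.1 *+ p ^ i == 0) = (z.2 *+ p ^ i == 0).
Proof.
move=> pa0 min_a; have pa x : x *+ p ^ a = 0 by rewrite -mulr_natr pa0 mulr0.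
elim: j i z => [|j IHj] i z Eij Fz; first by rewrite -[i]addn0 Eij !pa.
have [nil_z1|unit_z1] := boolP (nil z.1).
  have [c Fc ->] := frobenius_lift_divp Fz nil_z1.
  by rewrite pair_muln /= -!mulrnA -!expnS IHj // -Eij addSnnS.
have unit_neq0 u : ~~ nil u -> (u *+ p ^ i == 0) = false.
  move=> /unit_of_not_nilpotent[v uv]; apply/eqP=> /(congr1 ( *%R v)).
  rewrite mulr0 mulrnAr [v * u]mulrC uv => /min_a.
  by rewrite dvdn_Pexp2l ?prime_gt1 // -Eij addnS ltnNge leq_addr.
by rewrite !unit_neq0 // -frobenius_lift_nilpotent.
Qed.

Section Unramified.
Hypothesis unramified : forall x, nil x -> exists y, x = p%:R * y.

(** Successive approximation: each remainder is corrected by an element of [F] up to a multiple of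
    [p], and the process ends because [p ^ d = 0]. *)
Lemma p_adic_expansion (F : A -> Prop) :
  (forall x y, F x -> F y -> F (x + y)) -> (forall x, F x -> F (x *+ p)) ->
  (forall x, exists2 y, F y & nil (x - y)) -> forall x, F x.
Proof.
move=> FD FM Fres x.
have FMn y i : F y -> F (y *+ p ^ i).
  by move=> Fy; elim: i => // i IHi; rewrite expnSr mulrnA; apply: FM.
have [y [w [Fy ->]]] : exists y w, F y /\ x = y + w *+ p ^ d.
  elim: (d) => [|i [y [w [Fy Ex]]]].
    have [y Fy _] := Fres x.
    by exists y, (x - y); split=> //; rewrite addrC subrK.
  have [y' Fy' /unramified[w' Ew]] := Fres w.
  exists (y + y' *+ p ^ i), w'; split; first by apply: FD => //; apply: FMn.
  by rewrite Ex -[w](subrK y') Ew expnS mulrnA mulr_natl mulrnDl addrA addrAC.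
by rewrite -[w *+ _]mulr_natr natrX (eqP nil_p) mulr0 addr0.
Qed.

Lemma unramified_rigid x : rigid A -> nil (x ^+ p - x).
Proof.
move=> rigidA.
have [a [_ pa0 min_a]] := exists_characteristic_exponent.
have ann0 (z : A * A) : frobenius_lift z -> (z.1 == 0) = (z.2 == 0).
  by have := @frobenius_lift_annihilator a 0 a z pa0 min_a erefl.
(* The first projection is onto: its image contains all Teichmueller elements, which represent every
   residue class. *)
have [f Ff] : exists f : A -> A, forall x, frobenius_lift (x, f x).
  apply: (@fin_all_exists A (fun _ => A) (fun x y => frobenius_lift (x, y))).
  apply: p_adic_expansion => [u v [u' Fu] [v' Fv]|u [u' Fu]|u].
  - by exists (u' + v'); apply: FrobeniusD Fu Fv.
  - by exists (u' *+ p); have := subring_muln subF p Fu; rewrite pair_muln.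
  - exists (u ^+ q); last exact: nilpotent_sub_teichmuller.
    by exists (u ^+ (q * p)); apply: FrobeniusTeichmuller.
have f_uniq u v : frobenius_lift (u, v) -> f u = v.
  move=> Fuv; have := ann0 _ (FrobeniusD (Ff u) (FrobeniusN Fuv)).
  by rewrite /= subrr eqxx => /esym; rewrite subr_eq0 => /eqP.
have fid : f =1 id.
  apply: rigid_fun => // [|u v|u v|u v fuv].
  - by apply: f_uniq; apply: (subring1 subF).
  - by apply: f_uniq; apply: FrobeniusD (Ff u) (Ff v).
  - by apply: f_uniq; apply: (subringM subF (Ff u) (Ff v)).
  - apply/eqP; have := ann0 _ (FrobeniusD (Ff u) (FrobeniusN (Ff v))).
    by rewrite /= fuv subrr eqxx subr_eq0.
by have := frobenius_lift_congr (Ff x); rewrite /= fid.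
Qed.
End Unramified.

(** Over the prime field [X^p - X] is the product of the [X - i]. Working with integer polynomials
    transfers this to [A] modulo [p]; then some factor [x - i] is nilpotent. *)
Lemma exists_nat_residue x : nil (x ^+ p - x) -> exists i : nat, nil (x - i%:R).
Proof.
move=> nil_x.
pose g : {poly int} := \prod_(0 <= i < p) ('X - (i%:R)%:P) - ('X^p - 'X).
have g0 : map_poly (intr : int -> 'F_p) g = 0.
  rewrite /g rmorphB rmorph_prod /= rmorphB /= map_polyXn map_polyX.
  have := finField_genPoly 'F_p; rewrite card_Fp // => ->.
  apply/eqP; rewrite subr_eq0; apply/eqP.
  rewrite -[X in index_iota 0 X](Fp_cast pr_p) big_mkord.
  apply: eq_bigr => i _; rewrite rmorphB /= map_polyX map_polyC /=.
  by rewrite rmorph_nat (natr_Zp i).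
have nil_g : nil (map_poly intr g).[x].
  rewrite horner_coef; apply: (big_ind nil); [exact: nilpotent0 | exact: nilpotentD |].
  move=> i _; rewrite nilpotentMl // coef_map /=.
  have : (p %| g`_i)%Z.
    by rewrite (dvdz_pcharf (pchar_Fp pr_p)) -[_%:~R](coef_map intr) g0 coef0.
  by case/dvdzP=> c ->; rewrite intrM nilpotentMr.
have nil_prod : nil (\prod_(0 <= i < p) (x - i%:R)).
  have -> : \prod_(0 <= i < p) (x - i%:R) = (map_poly intr g).[x] + (x ^+ p - x).
    rewrite /g rmorphB rmorph_prod /= rmorphB /= map_polyXn map_polyX.
    rewrite !(hornerD, hornerN) hornerXn hornerX subrK horner_prod.
    apply: eq_bigr => i _.
    by rewrite rmorphB /= map_polyX map_polyC /= rmorph_nat !hornerE.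
  exact: nilpotentD.
elim: (index_iota 0 p) nil_prod => [|i r IHr]; first by rewrite big_nil nilpotent1.
by rewrite big_cons => /nilpotentM[|/IHr //]; exists i.
Qed.
End ResidueChar.
End LocalRing.

(** * The two kinds of factors *)

Lemma natr_modn (A : pzRingType) n k : (n%:R : A) = 0 -> (k %% n)%:R = k%:R :> A.
Proof. by move=> n0; rewrite [in RHS](divn_eq k n) natrD natrM n0 mulr0 add0r. Qed.

Lemma Zp_to_ring_morphism (A : pzRingType) n : (1 < n)%N -> (n%:R : A) = 0 ->
  exists f : {rmorphism 'Z_n -> A}, forall i : 'Z_n, f i = (i : nat)%:R.
Proof.
move=> n_gt1 n0; pose f (i : 'Z_n) : A := (i : nat)%:R.
have modE k : (k %% (Zp_trunc n).+2)%:R = k%:R :> A.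
  by rewrite Zp_cast // natr_modn.
have fB : zmod_morphism f.
  move=> i j; apply: (addIr (f j)); rewrite subrK /f -natrD -modE.
  by rewrite -[((_ + _) %% _)%N]/(nat_of_ord ((i - j) + j)%R) subrK.
have fM : monoid_morphism f.
  by split=> [|i j]; rewrite /f /= ?modE ?natrM // modE.
pose fA := GRing.isZmodMorphism.Build _ _ f fB.
pose fMm := GRing.isMonoidMorphism.Build _ _ f fM.
pose fR : {rmorphism 'Z_n -> A} := HB.pack f fA fMm.
by exists fR.
Qed.

Lemma inj_surj_bij (T U : finType) (f : T -> U) :
  injective f -> (forall y, exists x, f x = y) -> bijective f.
Proof.
move=> f_inj /fin_all_exists[g fg]; exists g => // x.
by apply: f_inj; rewrite fg.
Qed.

Lemma isomorphic_Zp (A : finComNzRingType) n : (1 < n)%N -> (n%:R : A) = 0 ->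
    (forall k, (k%:R : A) = 0 -> (n %| k)%N) ->
    (forall x : A, exists k, x = k%:R) ->
  ring_isomorphic A 'Z_n.
Proof.
move=> n_gt1 n0 min_n gen; apply: ring_isomorphic_sym.
have [f fE] := Zp_to_ring_morphism n_gt1 n0.
exists f; apply: inj_surj_bij => [i j /eqP|x].
  rewrite -subr_eq0 -rmorphB fE => /eqP/min_n.
  rewrite -[X in (X %| _)%N](Zp_cast n_gt1) => dvd; apply/eqP; rewrite -subr_eq0.
  move: (i - j) dvd => m dvd; apply/eqP/val_inj/eqP.
  rewrite -leqn0 leqNgt; apply/negP => gt0.
  by have := dvdn_leq gt0 dvd; rewrite leqNgt ltn_ord.
have [k ->] := gen x; exists (inZp k).
by rewrite fE /= natr_modn // Zp_cast.
Qed.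

Lemma isomorphic_dual_numbers (A : finComNzRingType) (t : A) :
    (2%:R : A) = 0 -> t != 0 -> t * t = 0 ->
    (forall x, [\/ x = 0, x = 1, x = t | x = 1 + t]) ->
  ring_isomorphic A {poly %/ ('X^2 : {poly 'Z_2})}.
Proof.
move=> two0 t0 tt0 gen; apply: ring_isomorphic_sym.
have [f fE] := @Zp_to_ring_morphism A 2 isT two0.
pose Q := {poly %/ ('X^2 : {poly 'Z_2})}.
pose g (u : Q) : A := f u`_0 + f u`_1 * t.
have gB : zmod_morphism g.
  by move=> u v; rewrite /g /= !coefB !rmorphB /=; ring.
have gM : monoid_morphism g.
  split=> [|u v]; first by rewrite /g /= !coefC /= rmorph0 rmorph1 mul0r addr0.
  (* Reduction modulo ['X^2] is truncation, so the coefficients below degree 2 are unchanged. *)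
  have E k : (k < 2)%N -> (u * v : Q)`_k = ((u : {poly 'Z_2}) * v)`_k.
    move=> k2 /=; move: (_ * _ : {poly 'Z_2}) => w.
    by rewrite mk_monic_Xn -Pdiv.RingMonic.take_poly_rmodp coef_take_poly k2.
  rewrite /g !E // !coefM !big_ord_recl !big_ord0 /= !addr0 !rmorphD !rmorphM /=.
  rewrite -[LHS]addr0 -(mulr0 (f u`_1 * f v`_1)) -tt0; ring.
pose gA := GRing.isZmodMorphism.Build _ _ g gB.
pose gMm := GRing.isMonoidMorphism.Build _ _ g gM.
pose gR : {rmorphism Q -> A} := HB.pack g gA gMm.
exists gR; apply: inj_surj_bij => [u v /= Euv|x].
  have key (i j : 'Z_2) : f i + f j * t = 0 -> i = 0 /\ j = 0.
    have cases (k : 'Z_2) : k = 0 \/ k = 1.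
      by case: k => [[|[|k]]] //= Hk; [left | right]; apply: val_inj.
    case: (cases i) => ->; case: (cases j) => ->;
      rewrite ?rmorph0 ?rmorph1 ?mul0r ?mul1r ?addr0 ?add0r //.
    - by move=> E; rewrite E eqxx in t0.
    - by move=> /eqP; rewrite oner_eq0.
    (* Multiplying [1 + t = 0] by [t] yields [t = 0]. *)
    move=> E; have := congr1 ( *%R t) E; rewrite mulrDr tt0 mulr1 addr0 mulr0 => E'.
    by rewrite E' eqxx in t0.
  have := gB u v; rewrite Euv subrr => /key[E0 E1].
  apply/eqP; rewrite -subr_eq0; apply/eqP/val_inj/polyP => -[|[|k]].
  - by rewrite E0 coef0.
  - by rewrite E1 coef0.
  - rewrite coef0 nth_default // -ltnS (leq_trans (size_mk_monic _)) //.
    by rewrite mk_monic_Xn size_polyXn.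
have val_in (i j : 'Z_2) : exists u, gR u = f i + f j * t.
  exists (in_qpoly _ (i%:P + j%:P * 'X)); rewrite /= /g /=.
  rewrite mk_monic_Xn -Pdiv.RingMonic.take_poly_rmodp !coef_take_poly.
  by rewrite !coefD !coefC !coefMX /= coefC addr0 add0r.
case: (gen x) => ->.
- by have := val_in 0 0; rewrite rmorph0 mul0r addr0.
- by have := val_in 1 0; rewrite rmorph0 rmorph1 mul0r addr0.
- by have := val_in 0 1; rewrite rmorph0 rmorph1 mul1r add0r.
- by have := val_in 1 1; rewrite rmorph1 mul1r.
Qed.

Lemma local_rigid_basic (A : finComNzRingType) :
  (forall e : A, e * e = e -> e = 0 \/ e = 1) -> rigid A -> basic_ring A.
Proof.
move=> idemA rigidA.
have [p pr_p nil_p] := exists_nilpotent_prime idemA.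
have [unram|/forallPn[z]] :=
  boolP [forall z : A, nilpotent z ==> [exists y, z == p%:R * y]]; last first.
  rewrite negb_imply => /andP[nil_z /existsPn z_notin].
  have [t [two0 t0 tt0 gen]] := ramified_rigid idemA pr_p nil_p nil_z z_notin rigidA.
  by right; apply: isomorphic_dual_numbers gen.
have {}unram (x : A) : nilpotent x -> exists y, x = p%:R * y.
  by move=> nil_x; have /existsP[y /eqP] := implyP (forallP unram x) nil_x; exists y.
left; have [a [a_gt0 pa0 min_a]] := exists_characteristic_exponent pr_p nil_p.
exists p, a; split=> //; apply: isomorphic_Zp => //.
  by rewrite -[1%N](expn0 p) ltn_exp2l ?prime_gt1.
(* The expansion is applied to the set of images of natural numbers, which meets every residue class
   by rigidity. *)
apply: (p_adic_expansion nil_p unram) => [_ _ [i ->] [j ->]|_ [i ->]|x].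
- by exists (i + j)%N; rewrite natrD.
- by exists (i * p)%N; rewrite mulrnA.
have nil_x := unramified_rigid idemA pr_p nil_p unram x rigidA.
have [i nil_xi] := exists_nat_residue idemA pr_p nil_p nil_x.
by exists i%:R; [exists i |].
Qed.

(** * Decomposition by primitive idempotents *)

(* The ring [e R], with unit [e]; its type depends on the proof that [e] is a
   nonzero idempotent so that the ring structure can be inferred. *)
Definition corner (R : finComPzRingType) (e : R)
  (_ : (e * e == e) && (e != 0)) : Type := {x : R | e * x == x}.

Section Corner.
Variables (R : finComPzRingType) (e : R) (idem_e : (e * e == e) && (e != 0)).
Local Notation C := (corner idem_e).
Implicit Types x y z : C.

HB.instance Definition _ := Finite.on C.

Let ee : e * e = e. Proof. by case/andP: idem_e => /eqP. Qed.

Lemma corner_proj_subproof (r : R) : e * (e * r) == e * r.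
Proof. by rewrite mulrA ee. Qed.
Definition corner_proj r : C := exist _ (e * r) (corner_proj_subproof r).
Definition corner_val x : R := sval x.

Lemma corner_valK x : e * corner_val x = corner_val x.
Proof. by apply/eqP; case: x. Qed.
Lemma corner_projE r : corner_val (corner_proj r) = e * r.
Proof. by []. Qed.
Lemma corner_val_inj : injective corner_val.
Proof. exact: val_inj. Qed.

Definition corner_opp x := corner_proj (- corner_val x).
Definition corner_add x y := corner_proj (corner_val x + corner_val y).
Definition corner_mul x y := corner_proj (corner_val x * corner_val y).

Fact corner_addA : associative corner_add.
Proof.
move=> x y z; apply: corner_val_inj.
by rewrite !corner_projE !mulrDr !corner_valK addrA.
Qed.
Fact corner_addC : commutative corner_add.
Proof. by move=> x y; apply: corner_val_inj; rewrite !corner_projE addrC. Qed.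
Fact corner_add0 : left_id (corner_proj 0) corner_add.
Proof.
by move=> x; apply: corner_val_inj; rewrite !corner_projE mulr0 add0r corner_valK.
Qed.
Fact corner_addN : left_inverse (corner_proj 0) corner_opp corner_add.
Proof.
move=> x; apply: corner_val_inj.
by rewrite !corner_projE !mulrN mulrDr mulrN !corner_valK addNr mulr0.
Qed.

HB.instance Definition _ := GRing.isZmodule.Build C
  corner_addA corner_addC corner_add0 corner_addN.

Fact corner_mulA : associative corner_mul.
Proof.
move=> x y z; apply: corner_val_inj; rewrite !corner_projE.
have E a b : e * (a * (e * b)) = e * (a * b).
  by rewrite mulrCA [e * (e * _)]mulrA ee mulrCA.
have F a b : e * (e * a * b) = e * (a * b).
  by rewrite [_ * b]mulrC E [b * a]mulrC.
by rewrite E F !mulrA.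
Qed.
Fact corner_mulC : commutative corner_mul.
Proof.
move=> x y; apply: corner_val_inj; rewrite !corner_projE.
by congr (_ * _); apply: mulrC.
Qed.
Fact corner_mul1 : left_id (corner_proj 1) corner_mul.
Proof.
by move=> x; apply: corner_val_inj; rewrite !corner_projE mulr1 !corner_valK.
Qed.
Fact corner_mulDl : left_distributive corner_mul corner_add.
Proof.
move=> x y z; apply: corner_val_inj; rewrite !corner_projE.
by rewrite !mulrA !mulrDr !mulrA ee -!mulrDl.
Qed.
Fact corner_1neq0 : corner_proj 1 != 0.
Proof.
apply/eqP=> /(congr1 corner_val); rewrite !corner_projE mulr1 mulr0.
by apply/eqP; case/andP: idem_e.
Qed.

HB.instance Definition _ := GRing.Zmodule_isComNzRing.Build C
  corner_mulA corner_mulC corner_mul1 corner_mulDl corner_1neq0.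

Lemma corner_valD x y : corner_val (x + y) = corner_val x + corner_val y.
Proof. by rewrite [LHS]corner_projE mulrDr !corner_valK. Qed.
Lemma corner_valM x y : corner_val (x * y) = corner_val x * corner_val y.
Proof. by rewrite [LHS]corner_projE mulrA corner_valK. Qed.
Lemma corner_val1 : corner_val 1 = e.
Proof. by rewrite [LHS]corner_projE mulr1. Qed.
Lemma corner_val0 : corner_val 0 = 0.
Proof. by rewrite [LHS]corner_projE mulr0. Qed.
Lemma corner_projD r s : corner_proj (r + s) = corner_proj r + corner_proj s.
Proof. by apply: corner_val_inj; rewrite corner_valD !corner_projE mulrDr. Qed.
Lemma corner_projM r s : corner_proj (r * s) = corner_proj r * corner_proj s.
Proof.
by apply: corner_val_inj; rewrite corner_valM !corner_projE mulrACA ee.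
Qed.
Lemma corner_proj1 : corner_proj 1 = 1.
Proof. by []. Qed.
Lemma corner_proj_val x : corner_proj (corner_val x) = x.
Proof. by apply: corner_val_inj; rewrite corner_projE corner_valK. Qed.

Lemma rigid_corner : rigid R -> rigid C.
Proof.
move=> rigidR f bij_f x.
pose g r := corner_val (f (corner_proj r)) + (1 - e) * r.
have eval y : (1 - e) * corner_val y = 0.
  by rewrite mulrBl mul1r corner_valK subrr.
have gid : g =1 id.
  apply: rigid_fun => // [|r s|r s|r s].
  - by rewrite /g corner_proj1 rmorph1 corner_val1 mulr1 addrC subrK.
  - by rewrite /g corner_projD rmorphD corner_valD mulrDr addrACA.
  - rewrite /g corner_projM rmorphM corner_valM.
    have idem : (1 - e) * (1 - e) = 1 - e.
      by rewrite mulrBr mulr1 mulrBl mul1r ee subrr subr0.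
    move: (eval (f (corner_proj r))) (eval (f (corner_proj s))).
    set u := corner_val _; set v := corner_val _ => eu ev.
    have -> : (u + (1 - e) * r) * (v + (1 - e) * s) = u * v
      + ((1 - e) * u) * s + ((1 - e) * v) * r + (1 - e) * (1 - e) * (r * s) by ring.
    by rewrite eu ev idem !mul0r !addr0.
  move=> Ers.
  (* Multiplication by [e] isolates the corner part, so injectivity of [g] can be checked on the two
     factors separately. *)
  have eg (y : R) : e * g y = corner_val (f (corner_proj y)).
    by rewrite /g mulrDr corner_valK mulrA mulrBr mulr1 ee subrr mul0r addr0.
  have : corner_proj r = corner_proj s.
    by apply: (bij_inj bij_f); apply: corner_val_inj; rewrite -!eg Ers.
  move=> Eprs; move: Ers; rewrite /g Eprs => /addrI.
  rewrite !mulrBl !mul1r -!corner_projE Eprs => /addIr //.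
apply: corner_val_inj; have := gid (corner_val x).
by rewrite /g corner_proj_val eval addr0.
Qed.
End Corner.

Definition primitive_idempotents (R : finComPzRingType) : {set R} :=
  [set e | (e * e == e) && (e != 0)
    & [forall f, (f * f == f) ==> ((e * f == 0) || (e * f == e))]].

Section PrimitiveIdempotents.
Variable R : finComPzRingType.
Local Notation E := (primitive_idempotents R).
Implicit Types e f : R.

Lemma primitive_idempotentP e : reflect
  [/\ e * e = e, e != 0 & forall f, f * f = f -> e * f = 0 \/ e * f = e] (e \in E).
Proof.
rewrite inE; apply: (iffP andP) => [[/andP[/eqP ee e0] /forallP min_e]|[ee e0 min_e]].
  split=> // f ff; have := implyP (min_e f); rewrite ff eqxx => /(_ isT).
  by case/orP=> /eqP; [left | right].
rewrite ee eqxx e0; split=> //; apply/forallP=> f; apply/implyP=> /eqP /min_e.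
by case=> ->; rewrite eqxx ?orbT.
Qed.

Lemma primitive_idempotents_orthogonal e f :
  e \in E -> f \in E -> e != f -> e * f = 0.
Proof.
move=> /primitive_idempotentP[ee e0 min_e] /primitive_idempotentP[ff f0 min_f].
have [-> //|ef] := min_e _ ff; have [fe|fe] := min_f _ ee; rewrite mulrC fe // in ef *.
by rewrite ef eqxx.
Qed.

(** Among the nonzero idempotents below [e], one with the smallest principal ideal is primitive: if
    [f * g] is nonzero it generates the same ideal as [f], so [f = a * f * g] and hence
    [f * g = f]. *)
Lemma primitive_idempotent_below e : e * e = e -> e != 0 ->
  exists2 f, f \in E & e * f = f.
Proof.
move=> ee e0.
pose P f := [&& f * f == f, f != 0 & e * f == f].
pose F f := #|[set a * f | a : R]|.
have Pe : P e by rewrite /P ee e0 eqxx.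
have [f /and3P[/eqP ff f0 /eqP ef] min_f] := arg_minnP F Pe.
exists f => //; apply/primitive_idempotentP; split=> // g gg.
have [fg0|fg0] := eqVneq (f * g) 0; [by left | right].
have Pfg : P (f * g) by rewrite /P fg0 mulrACA ff gg mulrA ef !eqxx.
have sub : [set a * (f * g) | a : R] \subset [set a * f | a : R].
  by apply/subsetP=> _ /imsetP[a _ ->]; rewrite mulrA mulrAC; apply: imset_f.
have /eqP EF : [set a * (f * g) | a : R] == [set a * f | a : R].
  by rewrite eqEcard sub; apply: min_f.
have : f \in [set a * (f * g) | a : R].
  by rewrite EF; apply/imsetP; exists 1; rewrite ?mul1r.
case/imsetP=> a _ Ef; rewrite {1}Ef.
by rewrite -!mulrA gg [RHS]Ef.
Qed.

(** By orthogonality the sum [s] is idempotent and fixes each primitive [f]. A nonzero [1 - s] would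
    lie above some such [f], yet it kills [f]. *)
Lemma sum_primitive_idempotents : \sum_(e in E) e = 1.
Proof.
set s := \sum_(e in E) e.
have fs f : f \in E -> f * s = f.
  move=> Ef; rewrite /s (bigD1 f) //= mulrDr mulr_sumr.
  rewrite big1 ?addr0 => [|g /andP[Eg neq]].
    by have /primitive_idempotentP[] := Ef.
  by apply: primitive_idempotents_orthogonal; rewrite // eq_sym.
have ss : s * s = s by rewrite {1}/s mulr_suml; apply: eq_bigr.
have [/eqP|s1] := eqVneq (1 - s) 0; first by rewrite subr_eq0 => /eqP.
have idem : (1 - s) * (1 - s) = 1 - s.
  by rewrite mulrBr mulr1 mulrBl mul1r ss subrr subr0.
have [f Ef] := primitive_idempotent_below idem s1.
rewrite mulrBl mul1r mulrC fs // subrr => f0.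
by have /primitive_idempotentP[_] := Ef; rewrite -f0 eqxx.
Qed.

Lemma primitive_idempotent_enum (i : 'I_#|E|) :
  (enum_val i * enum_val i == enum_val i) && (enum_val i != 0).
Proof.
by have /primitive_idempotentP[/eqP-> ->] := enum_valP i.
Qed.

Lemma corner_local (i : 'I_#|E|) (x : corner (primitive_idempotent_enum i)) :
  x * x = x -> x = 0 \/ x = 1.
Proof.
have /primitive_idempotentP[ee e0 min_e] := enum_valP i.
move=> /(congr1 (@corner_val _ _ _)); rewrite corner_valM => /min_e.
rewrite corner_valK; case=> Ex; [left | right]; apply: corner_val_inj.
  by rewrite Ex corner_val0.
by rewrite Ex corner_val1.
Qed.

Definition peirce_component (i : 'I_#|E|) : comPzRingType :=
  corner (primitive_idempotent_enum i).

(** The inverse sums the components: one composite is the identity because the idempotents sum to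
    [1], the other because they are orthogonal. *)
Lemma peirce_decomposition : ring_isomorphic R (directProduct peirce_component).
Proof.
pose P := directProduct peirce_component.
pose f (x : R) : P :=
  [ffun i => corner_proj (primitive_idempotent_enum i) x : peirce_component i].
pose g (u : P) : R := \sum_i corner_val (u i).
have fD x y : f (x + y) = f x + f y.
  by apply/ffunP=> i; rewrite dprod_addE !ffunE corner_projD.
have fB : zmod_morphism f.
  move=> x y; apply: (addIr (f y)); rewrite -fD !subrK //.
have fM : monoid_morphism f.
  split=> [|x y]; apply/ffunP=> i; first by rewrite !dprod_oneE.
  by rewrite dprod_mulE !ffunE corner_projM.
pose fA := GRing.isZmodMorphism.Build _ _ f fB.
pose fMm := GRing.isMonoidMorphism.Build _ _ f fM.
pose fR : {rmorphism R -> P} := HB.pack f fA fMm.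
exists fR; exists g => [x|u].
  rewrite /g /= -[RHS]mul1r -sum_primitive_idempotents mulr_suml.
  rewrite [RHS]big_enum_val /=; apply: eq_bigr => i _; by rewrite /f ffunE.
rewrite -[LHS]/(f (g u)); apply/ffunP=> i; rewrite /= /f ffunE; apply: corner_val_inj.
rewrite corner_projE /g mulr_sumr (bigD1 i) //= corner_valK big1 ?addr0 // => j neq_ji.
rewrite -corner_valK mulrA.
rewrite (primitive_idempotents_orthogonal (enum_valP i) (enum_valP j)) ?mul0r //.
by rewrite (inj_eq enum_val_inj) eq_sym.
Qed.
End PrimitiveIdempotents.

Theorem corollary3p2 (R : finComPzRingType)
    (hR : totally_disconnected (aut_graph R)) :
  exists (n : nat) (S : 'I_n -> comPzRingType),
    (forall i : 'I_n, basic_ring (S i)) /\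
    ring_isomorphic R (directProduct S).
Proof.
have rigidR : rigid R.
  move=> f bij_f x; apply/eqP/negPn/negP => /eqP fx.
  by apply: (hR x (f x)); split; [exact: nesym | exists (exist _ f bij_f)].
exists #|primitive_idempotents R|, (@peirce_component R).
split; last exact: peirce_decomposition.
move=> i; apply: (@local_rigid_basic (corner (primitive_idempotent_enum i))).
  exact: corner_local.
exact: rigid_corner.
Qed.
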